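(* Let $C$ be a Tychonoff space that is $\mathrm{cov}(\mathcal{M})$-concentrated. For each Tychonoff space $Y$ satisfying both $\mathsf{U}_{\mathrm{fin}}(\mathrm{O},\Gamma)$ and $\mathsf{S}_1(\Gamma,\mathrm{O})$, the product space $C\times Y$ satisfies $\mathsf{S}_1(\Gamma,\mathrm{O})$.
   Context: $\mathcal{M}$ is the ideal of meager subsets of $\mathbb{R}$, and $\mathrm{cov}(\mathcal{M})$ is the minimal number of meager sets whose union is $\mathbb{R}$. For an uncountable cardinal $\kappa$, a space $X$ is $\kappa$-concentrated if there is a countable set $D\subseteq X$ such that $|X\setminus U|<\kappa$ for every open set $U\supseteq D$. A cover of a space $X$ is a family $\mathcal{U}$ of subsets of $X$ with $X=\bigcup\mathcal{U}$ and $X\notin\mathcal{U}$. $\mathrm{O}(X)$ is the family of open covers of $X$. $\Gamma(X)$ is the family of infinite open covers $\mathcal{U}$ of $X$ such that each $x\in X$ belongs to all but finitely many members of $\mathcal{U}$. $X$ satisfies $\mathsf{S}_1(\Gamma,\mathrm{O})$ if for each sequence $\mathcal{U}_n\in\Gamma(X)$, $n\in\mathbb{N}$, there are $U_n\in\mathcal{U}_n$ such that $\{U_n : n\in\mathbb{N}\}\in\mathrm{O}(X)$. $X$ satisfies $\mathsf{U}_{\mathrm{fin}}(\mathrm{O},\Gamma)$ (the Hurewicz property) if for each sequence $\mathcal{U}_n\in\mathrm{O}(X)$, $n\in\mathbb{N}$, where no $\mathcal{U}_n$ contains a finite subcover, there are finite $\mathcal{F}_n\subseteq\mathcal{U}_n$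 such that $\{\bigcup\mathcal{F}_n : n\in\mathbb{N}\}\in\Gamma(X)$. *)

(* Defs.v *)
From HB Require Import structures.
From mathcomp Require Import all_boot all_order all_algebra.
From mathcomp Require Import all_classical all_reals all_analysis.
Import Order.TTheory GRing.Theory Num.Theory.
Import numFieldNormedType.Exports.

Set Implicit Arguments.
Unset Strict Implicit.
Unset Printing Implicit Defensive.

Local Open Scope classical_set_scope.
Local Open Scope card_scope.

(* The library's [completely_regular_space] separates points from closed sets
   by a uniformity; [uniform_separatorP] turns this into separation by a
   continuous function into [0, 1]. *)
Definition tychonoff_space (T : topologicalType) : Prop :=
  completely_regular_space T /\ hausdorff_space T.

Definition nowhere_dense (T : topologicalType) (A : set T) : Prop :=
  interior (closure A) = set0.

Definition meager (T : topologicalType) (A : set T) : Prop :=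
  exists F : nat -> set T,
    (forall n, nowhere_dense (F n)) /\ A = \bigcup_n F n.

Definition card_lt (T U : Type) (A : set T) (B : set U) : Prop :=
  A #<= B /\ ~ (B #<= A).

Definition meager_cover (T : topologicalType) (F : set (set T)) : Prop :=
  F `<=` @meager T /\ \bigcup_(A in F) A = setT.

(* A cardinal is represented by a set of that cardinality; here, a smallest
   family of meager sets covering T. When T has no meager cover, [get] returns
   a junk value; [cov_meagerP] shows that this does not happen for the reals. *)
Definition cov_meager (T : topologicalType) : set (set T) :=
  get [set F : set (set T) | meager_cover F /\
    forall G : set (set T), meager_cover G -> F #<= G].

Arguments cov_meager T : clear implicits.

Definition concentrated (K : Type) (kappa : set K) (X : topologicalType) :
    Prop :=
  exists D : set X, countable D /\
    forall U : set X, open U -> D `<=` U -> card_lt (~` U) kappa.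

Definition is_cover (T : Type) (U : set (set T)) : Prop :=
  \bigcup_(A in U) A = setT /\ ~ U setT.

Definition open_covers (X : topologicalType) : set (set (set X)) :=
  [set U | U `<=` open /\ is_cover U].

Definition gamma_covers (X : topologicalType) : set (set (set X)) :=
  [set U | [/\ open_covers U, infinite_set U &
    forall x : X, finite_set [set A | U A /\ ~ A x]]].

Arguments open_covers X : clear implicits.
Arguments gamma_covers X : clear implicits.

(* In the selection principles, the families selected are the ranges of the
   selecting sequences, so repetitions do not count. *)
Definition S1 (T : Type) (cA cB : set (set (set T))) : Prop :=
  forall U : nat -> set (set T), (forall n, cA (U n)) ->
  exists V : nat -> set T, (forall n, U n (V n)) /\ cB (range V).

Definition Ufin (T : Type) (cA cB : set (set (set T))) : Prop :=
  forall U : nat -> set (set T), (forall n, cA (U n)) ->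
  (forall n, ~ exists F, [/\ finite_set F, F `<=` U n & is_cover F]) ->
  exists F : nat -> set (set T),
    (forall n, finite_set (F n) /\ F n `<=` U n) /\
    cB (range (fun n => \bigcup_(A in F n) A)).

Definition S1_Gamma_O (X : topologicalType) : Prop :=
  S1 (gamma_covers X) (open_covers X).

Definition Hurewicz (X : topologicalType) : Prop :=
  Ufin (open_covers X) (gamma_covers X).

Lemma exists_min_card (U : Type) (P : set (set U)) : P !=set0 ->
  exists A, P A /\ forall B, P B -> A #<= B.
Proof.
move=> [B0 PB0]; apply: contrapT => noA.
pose Q (Z : set (set U -> U)) :=
  (forall f B, Z f -> P B -> B (f B)) /\
  (forall f g B, Z f -> Z g -> P B -> f B = g B -> f = g).
have [|Z [[Zin Zinj] Zmax]] := @Zorn_bigcup _ Q.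
  move=> F FQ Ftot; split=> [f B [Z FZ Zf]|f g B [Z FZ Zf] [Z' FZ' Zg]] PB.
    by have [FZin _] := FQ _ FZ; exact: (FZin f B Zf PB).
  have [ZZ'|Z'Z] := Ftot _ _ FZ FZ'.
    by have [_ inj] := FQ _ FZ'; apply: inj PB => //; exact: ZZ'.
  by have [_ inj] := FQ _ FZ; apply: inj PB => //; exact: Z'Z.
have ZB A : P A -> exists b, A b /\ forall f, Z f -> f A <> b.
  move=> PA; apply: contrapT => nb; apply: noA; exists A; split=> // B PB.
  have AZ : A `<=` (fun f : set U -> U => f A) @` Z.
    move=> b Ab; apply: contrapT => nZ; apply: nb; exists b; split=> // f Zf fb.
    by apply: nZ; exists f.
  apply: card_le_trans (subset_card_le AZ) _.
  apply: card_le_trans (card_image_le _ _) _.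
  have injB : {in Z &, injective (fun f : set U -> U => f B)}.
    by move=> f g /set_mem Zf /set_mem Zg; exact: Zinj.
  rewrite -(card_le_eql (inj_card_eq injB)).
  by apply: subset_card_le => _ [f Zf <-]; exact: Zin Zf PB.
have [b0 _] := ZB _ PB0.
have /choice[h hP] (A : set U) :
    exists b, P A -> A b /\ forall f, Z f -> f A <> b.
  have [PA|nPA] := pselect (P A); last by exists b0.
  by have [b Hb] := ZB _ PA; exists b.
apply: (Zmax (Z `|` [set h])).
  split; first by move=> f; left.
  by move=> /(_ h (or_intror erefl)) Zh; have [_ /(_ _ Zh)] := hP _ PB0.
split=> [f B [Zf|->] PB|f g B [Zf|->] [Zg|->] PB] //.
- exact: (Zin f B Zf PB).
- by have [] := hP _ PB.
- exact: Zinj.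
- by move=> fh; have [_ /(_ _ Zf)] := hP _ PB.
- by move=> /esym gh; have [_ /(_ _ Zg)] := hP _ PB.
Qed.

Lemma cov_meagerP (R : realType) :
  meager_cover (cov_meager R) /\
  forall G : set (set R), meager_cover G -> cov_meager R #<= G.
Proof.
apply: (@getPex _
  [set F : set (set R) | meager_cover F /\
     forall G : set (set R), meager_cover G -> F #<= G]).
apply: exists_min_card; exists (range (@set1 R)); split.
  move=> _ [x _ <-]; exists (fun=> [set x]); split=> [n|].
    have /closure_id clx : closed [set x].
      exact/accessible_closed_set1/hausdorff_accessible/norm_hausdorff.
    by rewrite /nowhere_dense -clx interior_set1.
  by rewrite bigcup_const.
by apply/seteqP; split=> // x _; exists [set x].
Qed.

Lemma cov_meager_uncountable (R : realType) : ~ countable (cov_meager R).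
Proof.
have [[covm covT] _] := cov_meagerP R.
move=> /pfcard_geP[cov0|[f]].
  by have : [set: R] 0%R by []; rewrite -covT cov0 bigcup_set0.
have /choice[G GP] n : exists G : nat -> set R,
    (forall k, nowhere_dense (G k)) /\ f n = \bigcup_k G k.
  by apply: covm; apply: (@funS _ _ _ _ f).
pose O m : set R := if unpickle m is Some nk
  then ~` closure (G nk.1 nk.2) else setT.
have Oopen m : open (O m) /\ dense (O m).
  rewrite /O; case: unpickle => [[n k]/=|]; last first.
    split; first exact: openT.
    by move=> V V0 _; rewrite setIT.
  split; first by rewrite openC; exact: closed_closure.
  move=> V [x Vx] oV; apply: contrapT => VG.
  have /(_ k) := (GP n).1; rewrite /nowhere_dense => /seteqP[+ _] => /(_ x).
  apply; apply: filterS (open_nbhs_nbhs (conj oV Vx)).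
  by move=> y Vy; apply: contrapT => nG; apply: VG; exists y.
have [||x [_ Ox]] := Baire Oopen (O := setT); [by exists 0%R|exact: openT|].
have : [set: R] x by []; rewrite -covT => -[A /(@surj _ _ _ _ f)[n _ <-]].
have [_ fnE] := GP n; rewrite /= in fnE *; rewrite fnE => -[k _ Gx].
have := Ox (pickle (n, k)) I; rewrite /O pickleK /=; apply.
exact: subset_closure.
Qed.

(* Main.v *)
Require Import Defs.
From mathcomp Require Import all_boot all_order all_algebra.
From mathcomp Require Import all_classical all_reals all_analysis.
From mathcomp Require Import lra.
Import Order.TTheory GRing.Theory Num.Theory.
Import numFieldNormedType.Exports.

(** Each gamma cover contains a sequence of distinct members, and every point
    lies in almost all terms of it.  The n-th cover is therefore replaced by a
    row [u n : nat -> set (C * Y)] of an array, and the task is to find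
    [f : nat -> nat] such that the sets [u n (f n)] cover the product.
    Splitting the rows into countably many infinite blocks allows countably
    many tasks to be treated independently ([glue_selections]).

    Let [d] enumerate a countable set on which C is concentrated.  Since Y
    satisfies S1(Gamma, O), one block per point [d k] gives an open set W
    that contains [{d k} * Y] for all k.  For compact Y the tube lemma would
    yield an open set G around the points [d k] with [G * Y] inside W.  The
    Hurewicz property yields as much with a G_delta set, the intersection of
    open sets [G m] around the points [d k] ([Hurewicz_tube]).  By
    concentration, each complement [~` G m] has fewer than cov(M) points.  A
    point of the product outside W has its first coordinate in one of these
    complements.  Each of them receives its own block, because a countable
    union of sets smaller than cov(M) might reach cardinality cov(M).

    It remains to cover [S * Y] when S has fewer than cov(M) points
    ([small_product_select]).  For one point c, S1(Gamma, O) gives a selection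
    covering the fibre on each of infinitely many blocks of rows.  The Hurewicz
    property cuts block l down to a finite piece [t l] of its selection, such
    that each point of the fibre is covered by [t l] for almost all l.  So a
    selection that contains [t l] for infinitely many l covers the fibre
    ([decoded_select]).  Coding finite sequences by numbers, we need
    one [g : nat -> nat] that agrees infinitely often with each of fewer than
    cov(M) functions [t].  This is the easy half of Bartoszynski's
    characterisation of cov(M): the reals x whose associated function [guess x]
    is eventually different from [t] form a meager set, and fewer than cov(M)
    such sets do not cover the line ([guess_all]). *)

Set Implicit Arguments.
Unset Strict Implicit.
Unset Printing Implicit Defensive.

Local Open Scope classical_set_scope.
Local Open Scope card_scope.

(** * Covers as sequences *)

Lemma near_finite_forall (T : Type) (I : choiceType) (F : set_system T)
    {FF : Filter F} (A : set I) (P : I -> T -> Prop) :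
  finite_set A -> (forall i, A i -> \forall t \near F, P i t) ->
  \forall t \near F, forall i, A i -> P i t.
Proof.
move=> /finite_seqP[s ->]; elim: s => [|i s IH] sP.
  by apply: filterE => t i; rewrite /= in_nil.
have Pi : \forall t \near F, P i t by apply: sP; rewrite /= mem_head.
have Ps : \forall t \near F, forall j, [set` s] j -> P j t.
  by apply: IH => j js; apply: sP; rewrite /= inE; apply/orP; right.
apply: filterS2 Pi Ps => t Pit Pst j; rewrite /= inE => /orP[/eqP -> //|].
exact: Pst.
Qed.

Section families.
Variable X : topologicalType.

Lemma near_injective_neq (T : Type) (u : nat -> T) (a : T) :
  injective u -> \forall m \near \oo, u m <> a.
Proof.
move=> u_inj; have [[k uka]|no] := pselect (exists k, u k = a); last first.
  by apply: nearW => m uma; apply: no; exists m.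
exists k.+1 => // m /= km; rewrite -uka => /u_inj mk.
by rewrite mk ltnn in km.
Qed.

(** In contrast to a gamma cover, repetitions and the whole space are
    allowed among the terms, so that sections of a gamma sequence along a fibre
    of a product are again gamma sequences. *)
Definition gamma_seq (u : nat -> set X) : Prop :=
  (forall m, open (u m)) /\ forall x, \forall m \near \oo, u m x.

Lemma gamma_cover_seq (U : set (set X)) : gamma_covers X U ->
  exists2 u : nat -> set X, (forall m, U (u m)) & gamma_seq u.
Proof.
move=> [[Uop _] /infiniteP /pcard_leP[u] Ufin].
have u_inj : injective u by move=> i j; apply: (@inj _ _ _ u); rewrite inE.
have Uu m : U (u m) by apply: (@funS _ _ _ _ u).
exists u => //; split=> [m|x]; first exact/Uop/Uu.
apply: filterS (near_finite_forall (Ufin x)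
  (fun A _ => near_injective_neq A u_inj)) => m mP.
by apply: contrapT => num; exact: (mP (u m)).
Qed.

(** The range is infinite because a set [u k] distinct from X omits a
    point, which almost all [u m] contain; so each set occurs finitely often. *)
Lemma gamma_cover_range (u : nat -> set X) : gamma_seq u ->
  (forall m, u m <> setT) -> gamma_covers X (range u).
Proof.
move=> [uop ux] uT; split.
- split; first by move=> _ [m _ <-].
  split; last by move=> [m _ /uT].
  apply/seteqP; split=> // x _.
  have [N _ /(_ N (leqnn N)) uNx] := ux x.
  by exists (u N) => //; exists N.
- move=> ufin.
  have [_ [m _ <-]|N _ /(_ N (leqnn N) (u N))] := near_finite_forall
      (P := fun A m => u m <> A) (F := \oo) ufin; last by apply=> //; exists N.
  have [x nux] : exists x, ~ u m x.
    apply: contrapT => no; apply: (uT m); apply/seteqP; split=> // x _.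
    by apply: contrapT => nux; apply: no; exists x.
  by apply: filterS (ux x) => k ukx ukm; apply: nux; rewrite -ukm.
- move=> x; have [N _ uN] := ux x.
  apply: (@sub_finite_set _ _ (u @` `I_N)); last exact/finite_image/finite_II.
  move=> _ [[m _ <-]] nux; exists m => //=; rewrite ltnNge.
  by apply/negP => /uN.
Qed.

(** If the whole space occurs in some row, selecting it there suffices;
    otherwise every row has a gamma cover as its range. *)
Lemma S1_Gamma_O_select (u : nat -> nat -> set X) : S1_Gamma_O X ->
  (forall n, gamma_seq (u n)) -> exists f, \bigcup_n u n (f n) = setT.
Proof.
move=> s1 ug; have [[n [m unm]]|no] := pselect (exists n m, u n m = setT).
  exists (fun=> m); apply/seteqP; split=> // x _; exists n => //.
  by rewrite unm.
have ugam n : gamma_covers X (range (u n)).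
  by apply: gamma_cover_range => // m unm; apply: no; exists n, m.
have [V [Vu [_ [VT _]]]] := s1 _ ugam.
have /choice[f fP] n : exists m, u n m = V n.
  by have [m _ <-] := Vu n; exists m.
exists f; rewrite -VT; apply/seteqP; split=> x.
  by move=> [n _]; rewrite fP => Vx; exists (V n) => //; exists n.
by move=> [_ [n _ <-] Vx]; exists n => //; rewrite fP.
Qed.

(** * The Hurewicz property for ideals of open sets *)

(** Such an ideal stands for all finite unions of members of an open cover,
    together with their open subsets.  Ideals are easier to intersect than
    covers are to refine. *)
Record open_ideal (P : set (set X)) : Prop := OpenIdeal {
  ideal_open : P `<=` open;
  ideal0 : P set0;
  idealU : forall V W, P V -> P W -> P (V `|` W);
  ideal_sub : forall V W, open W -> W `<=` V -> P V -> P W;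
  ideal_cover : forall x, exists2 V, P V & V x }.

Lemma ideal_bigcup (P F : set (set X)) : open_ideal P -> finite_set F ->
  F `<=` P -> P (\bigcup_(A in F) A).
Proof.
move=> Pid /finite_seqP[s ->] sP; rewrite bigcup_seq big_seq.
elim/big_ind: _ => [|V W|V Vs]; [exact: ideal0|exact: idealU|exact: sP].
Qed.

Lemma open_ideal_prefix (P : nat -> set (set X)) (n : nat) :
  (forall i, open_ideal (P i)) ->
  open_ideal [set V | forall i, (i <= n)%N -> P i V].
Proof.
move=> Pid; split.
- by move=> V /(_ 0%N isT); exact: ideal_open.
- by move=> i _; exact: ideal0.
- by move=> V W VP WP i lein; apply: idealU => //; [exact: VP|exact: WP].
- by move=> V W Wop WV VP i lein; apply: ideal_sub WV _ => //; exact: VP.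
- move=> x; elim: n => [|n [V VP Vx]].
    have [V PV Vx] := ideal_cover (Pid 0%N) x; exists V => // i.
    by rewrite leqn0 => /eqP ->.
  have [W PW Wx] := ideal_cover (Pid n.+1) x.
  have Vop : open V := ideal_open (Pid 0%N) (VP 0%N isT).
  have Wop : open W := ideal_open (Pid n.+1) PW.
  exists (V `&` W) => // i; rewrite leq_eqVlt => /orP[/eqP ->|lein].
    by apply: (ideal_sub (Pid _) _ _ PW); [exact: openI|exact: subIsetr].
  by apply: (ideal_sub (Pid _) _ _ (VP _ lein)); [exact: openI|exact: subIsetl].
Qed.

(** The sequence [E \o s] takes no value infinitely often, and
    [s] dominates the identity. *)
Lemma infinite_range_new (T : Type) (E : nat -> T) :
  infinite_set (range E) ->
  exists s : nat -> nat, forall i k, (k < i)%N -> E (s i) <> E k.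
Proof.
move=> Einf; suff /choice[s sP] (i : nat) :
    exists n, forall k, (k < i)%N -> E n <> E k by exists s.
apply: contrapT => no; apply: Einf.
apply: (@sub_finite_set _ _ (E @` `I_i)); last exact/finite_image/finite_II.
move=> _ [n _ <-]; apply: contrapT => nE; apply: no; exists n => k ki Enk.
by apply: nE; exists k.
Qed.

(** The gamma cover given by the Hurewicz property is a family of sets, so a
    set missing a point y could be [E n] for infinitely many n.  Two devices
    repair this.  Replacing [P n] by the intersection [Q n] of [P 0], ..., [P n]
    lets a set obtained for a late index serve for all earlier ones, and
    [infinite_range_new] provides late indices at which no set recurs
    infinitely often. *)
Lemma Hurewicz_ideals (P : nat -> set (set X)) : Hurewicz X ->
  (forall n, open_ideal (P n)) ->
  exists V : nat -> set X, (forall n, P n (V n)) /\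
    forall x, \forall n \near \oo, V n x.
Proof.
move=> hurX Pid.
pose Q n := [set V | forall i, (i <= n)%N -> P i V].
have Qid n : open_ideal (Q n) by exact: open_ideal_prefix.
(* Either the whole space is always available, or it is missing from some
   index on, as [Q] is decreasing. *)
have [QT|/existsNP[n0 nQT]] := pselect (forall n, Q n setT).
  exists (fun=> setT); split=> [n|x]; first exact: (QT n).
  exact: nearW.
have Qmono m n V : (m <= n)%N -> Q n V -> Q m V.
  by move=> lemn QV i /leq_trans /(_ lemn); exact: QV.
have nQ n : ~ Q (n0 + n)%N setT by move=> /(Qmono n0) H; apply/nQT/H/leq_addr.
have [|n [F [Ffin FQ [FT _]]]|F [FQ [_ Einf Efin]]] :=
  hurX (fun n => Q (n0 + n)%N).
- move=> n; split; first exact: ideal_open.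
  split=> //; apply/seteqP; split=> // x _.
  by have [V QV Vx] := ideal_cover (Qid (n0 + n)%N) x; exists V.
- by apply: (nQ n); rewrite -FT; exact: ideal_bigcup.
set E := fun n => \bigcup_(A in F n) A in Einf Efin.
have QE n : Q (n0 + n)%N (E n).
  by have [? ?] := FQ n; exact: ideal_bigcup.
have [s sP] := infinite_range_new Einf.
have s_ge i : (i <= s i)%N.
  by rewrite leqNgt; apply/negP => /sP; exact.
exists (E \o s); split=> [i|x].
  by apply: (QE (s i)); rewrite (leq_trans (s_ge i)) ?leq_addl.
have sE A : [set A | range E A /\ ~ A x] A -> \forall i \near \oo, E (s i) <> A.
  by move=> [[k _ <-] _]; apply: filterS (nbhs_infty_gt k) => i; exact: sP.
apply: filterS (near_finite_forall (Efin x) sE) => i iP.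
by apply: contrapT => nE; apply: (iP (E (s i))).
Qed.

End families.

(** * Products with the points of a sequence *)

(** The rows with index [pickle (p, q)], for q in nat, form the block
    reserved for [Z p]. *)
Lemma glue_selections (T : Type) (u : nat -> nat -> set T)
    (Z : nat -> set T) :
  (forall p, exists f : nat -> nat,
    Z p `<=` \bigcup_q u (pickle (p, q)) (f q)) ->
  exists f : nat -> nat, \bigcup_p Z p `<=` \bigcup_n u n (f n).
Proof.
move=> /choice[f fP].
exists (fun n => if unpickle n is Some pq then f pq.1 pq.2 else 0%N).
move=> x [p _ /fP[q _ ux]]; exists (pickle (p, q)) => //.
by rewrite pickleK.
Qed.

Section products.
Variables C Y : topologicalType.

Definition slice (c : C) (W : set (C * Y)) : set Y := [set y | W (c, y)].

Lemma open_slice (c : C) (W : set (C * Y)) : open W -> open (slice c W).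
Proof.
move=> Wop; rewrite /slice.
have : continuous (fun y : Y => (c, y)).
  by move=> y; apply: cvg_pair; [exact: cvg_cst|exact: cvg_id].
by move=> /continuousP /(_ _ Wop).
Qed.

Lemma gamma_seq_slice (c : C) (u : nat -> set (C * Y)) :
  gamma_seq u -> gamma_seq (fun m => slice c (u m)).
Proof.
by move=> [uop ux]; split=> [m|y]; [exact: open_slice|exact: (ux (c, y))].
Qed.

Lemma open_box (W : set (C * Y)) (c : C) (y : Y) : open W -> W (c, y) ->
  exists N V, [/\ open N, open V, N c, V y & N `*` V `<=` W].
Proof.
move=> Wop Wcy; have [[A B] [/= Ac By] ABW] : nbhs (c, y) W.
  exact: open_nbhs_nbhs.
exists (interior A), (interior B); split=> //; try exact: open_interior.
by move=> [a b] [/= aA bB]; apply: ABW; split; exact: interior_subset.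
Qed.

(** Apply [Hurewicz_ideals] to the ideals, indexed by j, of the open sets V
    such that each of [d 0], ..., [d j] has a neighbourhood N with [N * V]
    inside W.  They yield sets [V j], and neighbourhoods [N (j, k)] of [d k] for
    k <= j; let [G m] be the union of the [N (j, k)] with j >= m.  If c lies in
    every [G m] and y in [V j] for all j >= m, then c lies in some [N (j, k)]
    with j >= m, hence (c, y) lies in W. *)
Lemma Hurewicz_tube (W : set (C * Y)) (d : nat -> C) : Hurewicz Y -> open W ->
  (forall k y, W (d k, y)) ->
  exists G : nat -> set C, (forall m, open (G m) /\ range d `<=` G m) /\
    (\bigcap_m G m) `*` setT `<=` W.
Proof.
move=> hurY Wop Wd.
pose P k := [set V : set Y | open V /\
  exists2 N : set C, open N /\ N (d k) & N `*` V `<=` W].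
have Pid k : open_ideal (P k).
  split.
  - by move=> V [].
  - split; first exact: open0.
    by exists setT; [split=> //; exact: openT|move=> [c y] []].
  - move=> V V' [Vop [N [Nop Nd] NV]] [V'op [N' [N'op N'd] NV']].
    split; first exact: openU.
    exists (N `&` N'); first by split=> //; exact: openI.
    move=> [c y] [/= [Nc N'c] [Vy|V'y]]; [exact: NV|exact: NV'].
  - move=> V V' V'op V'V [_ [N NP NV]]; split=> //; exists N => //.
    by move=> [c y] [/= Nc V'y]; apply: NV; split=> //; exact: V'V.
  - move=> y; have [N [V [Nop Vop Nd Vy NV]]] := open_box Wop (Wd k y).
    by exists V => //; split=> //; exists N.
have [V [VP Vnear]] := Hurewicz_ideals hurY (fun j => open_ideal_prefix j Pid).
have /choice[N NP] (jk : nat * nat) : exists N : set C, (jk.2 <= jk.1)%N ->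
    [/\ open N, N (d jk.2) & N `*` V jk.1 `<=` W].
  have [lekj|] := boolP (jk.2 <= jk.1)%N; last by exists set0.
  by have [_ [N [? ?] ?]] := VP _ _ lekj; exists N.
pose J m := [set jk : nat * nat | (m <= jk.1)%N /\ (jk.2 <= jk.1)%N].
exists (fun m => \bigcup_(jk in J m) N jk).
split=> [m|[c y] [/= Gc _]].
  split; first by apply: bigcup_open => jk [_ /NP[]].
  move=> _ [k _ <-]; exists (maxn m k, k); rewrite /J /= ?leq_maxl ?leq_maxr //.
  by have [] := NP (maxn m k, k) (leq_maxr _ _).
have [m _ Vm] := Vnear y.
have [jk [mj kj] Nc] := Gc m I; have [_ _] := NP _ kj; apply.
by split=> //=; exact: Vm.
Qed.

End products.

(** * Meager sets and infinitely often equal functions *)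

Section guessing.
Variable R : realType.
Local Open Scope ring_scope.

(** If the fractional part th of x * 2^l is positive, this is the v such that
    1/(v+2) < th <= 1/(v+1).  On every dyadic interval of length 2^-l, it
    takes every value v on some nonempty open subinterval. *)
Definition guess (x : R) (l : nat) : nat :=
  (Num.truncn (x * 2 ^+ l - (Num.floor (x * 2 ^+ l))%:~R)^-1).-1.

(** A dyadic interval of length 2^-l around x is short enough once l is
    large, and l may be taken large because agreement with [t] is required at
    one index above m only. *)
Lemma guess_interval (x e : R) (t : nat -> nat) (m : nat) : 0 < e ->
  exists2 l, (m <= l)%N & exists a b : R, a < b /\
    forall y : R, a < y < b -> `|x - y| < e /\ guess y l = t l.
Proof.
move=> e0.
have [l lm le] : exists2 l, (m <= l)%N & 2 ^- l < e.
  have [N _ NP] := near_infty_natSinv_expn_lt (PosNum e0).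
  exists (maxn m N); rewrite ?leq_maxl //.
  by have := NP (maxn m N) (leq_maxr _ _); rewrite /= mul1r.
exists l => //; set v := t l.
have p0 : 0 < 2 ^+ l :> R by exact: exprn_gt0.
set F := Num.floor (x * 2 ^+ l).
have /andP[Fx xF] : F%:~R <= x * 2 ^+ l < (F + 1)%:~R by exact: floor_itv.
rewrite intrD mulr1z in xF.
set i1 : R := v.+1%:R^-1; set i2 : R := v.+2%:R^-1.
have i21 : i2 < i1 by rewrite ltf_pV2 ?posrE ?ltr0n // ltr_nat.
have i1_le1 : i1 <= 1 by rewrite invf_le1 ?ltr0n // ler1n.
have i2_gt0 : 0 < i2 by rewrite invr_gt0 ltr0n.
have [i1E i2E] : i1^-1 = v.+1%:R /\ i2^-1 = v.+2%:R by rewrite !invrK.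
clearbody F i1 i2.
exists ((F%:~R + i2) / 2 ^+ l), ((F%:~R + i1) / 2 ^+ l).
split; first by rewrite ltr_pM2r ?invr_gt0 // ltrD2l.
move=> y; rewrite ltr_pdivrMr // ltr_pdivlMr // => /andP[ay yb].
split.
  apply: lt_trans le; rewrite -(ltr_pM2r p0) mulVf ?gt_eqF //.
  rewrite -[X in _ * X](gtr0_norm p0) -normrM mulrBl ltr_norml.
  by apply/andP; split; lra.
have Fy : Num.floor (y * 2 ^+ l) = F.
  by apply: floor_def; rewrite intrD mulr1z; apply/andP; split; lra.
rewrite /guess Fy; set th := _ - _.
have th2 : i2 < th by rewrite /th; lra.
have th1 : th < i1 by rewrite /th; lra.
have th0 : 0 < th by exact: lt_trans th2.
rewrite (@truncn_def _ _ v.+1) // -i1E -i2E lef_pV2 ?ltf_pV2 ?posrE //.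
  by rewrite (ltW th1).
exact: lt_trans i21.
Qed.

Lemma meager_guess_neq (t : nat -> nat) :
  meager [set x : R | \forall l \near \oo, guess x l <> t l].
Proof.
exists (fun m => [set x | forall l, (m <= l)%N -> guess x l <> t l]).
split; last first.
  apply/seteqP; split=> x; first by move=> [m _ mP]; exists m.
  by move=> [m _ mP]; exists m.
move=> m; apply/seteqP; split=> // x /nbhs_ballP[e /= e0 xe].
have [l ml [a [b [ab abP]]]] := guess_interval x t m e0.
have mid : a < (a + b) / 2 < b by apply/andP; split; lra.
have /xe /(_ `]a, b[%classic) [|z [zP]] := (abP _ mid).1.
  by apply: near_in_itvoo; rewrite in_itv.
by rewrite /= in_itv /= => /abP[_]; exact: zP.
Qed.

(** Otherwise the meager sets attached to the functions [t c] would cover the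
    line with fewer than cov(M) sets. *)
Lemma guess_all (K : Type) (S : set K) (t : K -> nat -> nat) :
  card_lt S (cov_meager R) ->
  exists g : nat -> nat,
    forall c, S c -> forall m, exists2 l, (m <= l)%N & g l = t c l.
Proof.
move=> [_ nle]; have [_ covmin] := cov_meagerP R.
pose M c := [set x : R | \forall l \near \oo, guess x l <> t c l].
have [x nx] : exists x, ~ (\bigcup_(c in S) M c) x.
  apply: contrapT => no; apply: nle; apply: card_le_trans (card_image_le M S).
  apply: covmin; split; first by move=> _ [c _ <-]; exact: meager_guess_neq.
  apply/seteqP; split=> // x _; rewrite bigcup_image.
  by apply: contrapT => nx; apply: no; exists x.
exists (guess x) => c Sc m; apply: contrapT => no; apply: nx; exists c => //.
by exists m => // l /= ml gl; apply: no; exists l.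
Qed.

End guessing.

(** * Products with sets of size less than cov(M) *)

Section single_fibre.
Variable Y : topologicalType.

(** The value [g l] codes a finite sequence, whose i-th entry is the selection
    in the i-th row of block l. *)
Definition decoded (g : nat -> nat) (n : nat) : nat :=
  if unpickle n is Some (l, i) then
    nth 0%N (odflt [::] (unpickle (g l) : option (seq nat))) i
  else 0%N.

(** Here [t l] codes an initial segment, of length [r l], of a selection
    covering Y on block l.  The Hurewicz property, applied to the ideals of
    open sets covered by such initial segments, provides the lengths. *)
Lemma decoded_select (u : nat -> nat -> set Y) : Hurewicz Y -> S1_Gamma_O Y ->
  (forall n, gamma_seq (u n)) ->
  exists t : nat -> nat, forall g : nat -> nat,
    (forall m, exists2 l, (m <= l)%N & g l = t l) ->
    \bigcup_n u n (decoded g n) = setT.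
Proof.
move=> hurY s1Y ug.
have /choice[s sP] (l : nat) :
    exists s : nat -> nat, \bigcup_i u (pickle (l, i)) (s i) = setT.
  exact: (S1_Gamma_O_select s1Y (fun i => ug (pickle (l, i)))).
pose W l r := \bigcup_(i in `I_r) u (pickle (l, i)) (s l i).
have Wmono l r r' : (r <= r')%N -> W l r `<=` W l r'.
  by move=> rr' y [i /= ir uy]; exists i => //=; exact: leq_trans rr'.
pose P l := [set V : set Y | open V /\ exists r, V `<=` W l r].
have Pid l : open_ideal (P l).
  split.
  - by move=> V [].
  - by split; [exact: open0|exists 0%N].
  - move=> V V' [Vop [r Vr]] [V'op [r' Vr']]; split; first exact: openU.
    exists (maxn r r') => y [/Vr|/Vr']; apply: Wmono.
      exact: leq_maxl.
    exact: leq_maxr.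
  - move=> V V' V'op V'V [_ [r Vr]]; split=> //; exists r.
    exact: subset_trans Vr.
  - move=> y; have : [set: Y] y by []; rewrite -(sP l) => -[i _ uy].
    exists (u (pickle (l, i)) (s l i)) => //; split; first exact: (ug _).1.
    by exists i.+1 => z uz; exists i => /=.
have [V [VP Vnear]] := Hurewicz_ideals hurY Pid.
have /choice[r rP] (l : nat) : exists r, V l `<=` W l r by have [] := VP l.
exists (fun l => pickle (mkseq (s l) (r l))) => g gt.
apply/seteqP; split=> // y _.
have [m _ Vm] := Vnear y; have [l ml gl] := gt m.
have [i /= ir uy] := rP _ _ (Vm _ ml).
exists (pickle (l, i)) => //.
by rewrite /decoded pickleK gl pickleK /= nth_mkseq.
Qed.

End single_fibre.

Lemma small_product_select (R : realType) (C Y : topologicalType) (S : set C)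
    (u : nat -> nat -> set (C * Y)) :
  card_lt S (cov_meager R) -> Hurewicz Y -> S1_Gamma_O Y ->
  (forall n, gamma_seq (u n)) ->
  exists f : nat -> nat, S `*` setT `<=` \bigcup_n u n (f n).
Proof.
move=> Ssmall hurY s1Y ug.
have /choice[t tP] c := decoded_select hurY s1Y
  (fun n => gamma_seq_slice c (ug n)).
have [g gP] := guess_all t Ssmall.
exists (decoded g) => -[c y] [/= Sc _].
have : [set: Y] y by []; rewrite -(tP c g (gP c Sc)) => -[n _ uy].
by exists n.
Qed.

Lemma countable_product_select (C Y : topologicalType) (d : nat -> C)
    (u : nat -> nat -> set (C * Y)) : S1_Gamma_O Y ->
  (forall n, gamma_seq (u n)) ->
  exists f : nat -> nat, range d `*` setT `<=` \bigcup_n u n (f n).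
Proof.
move=> s1Y ug.
have [k|f fP] := @glue_selections _ u (fun k => [set d k] `*` setT).
  have [f fT] := S1_Gamma_O_select s1Y
    (fun q => gamma_seq_slice (d k) (ug (pickle (k, q)))).
  exists f => -[c y] [/= -> _].
  have : [set: Y] y by []; rewrite -fT => -[q _ uy].
  by exists q.
by exists f => -[_ y] [/= [k _ <-] _]; apply: fP; exists k.
Qed.

(** * The product theorem *)

Theorem theorem3p5 (R : realType) (C : topologicalType)
  (tychC : tychonoff_space C) (concC : concentrated (cov_meager R) C)
  (Y : topologicalType) (tychY : tychonoff_space Y)
  (hurY : Hurewicz Y) (s1Y : S1_Gamma_O Y) :
  S1_Gamma_O (C * Y)%type.
Proof.
move=> U Ugam.
have /choice[u uP] (n : nat) : exists u : nat -> set (C * Y),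
    (forall m, U n (u m)) /\ gamma_seq u.
  by have [u ? ?] := gamma_cover_seq (Ugam n); exists u.
have ug n : gamma_seq (u n) by have [] := uP n.
suff [f fT] : exists f : nat -> nat, \bigcup_n u n (f n) = setT.
  exists (fun n => u n (f n)); split=> [n|]; first exact: (uP n).1.
  split; first by move=> _ [n _ <-]; exact: (ug n).1.
  split; last first.
    move=> [n _ unT]; have [[_ [_ nT]] _ _] := Ugam n.
    by apply: nT; rewrite -unT; exact: (uP n).1.
  by rewrite bigcup_image.
have [[c0 _]|C0] := pselect (exists c : C, True); last first.
  exists (fun=> 0%N); apply/seteqP; split=> // -[c y] _.
  by case: C0; exists c.
have [D [Dcount Dconc]] := concC.
(* A sequence enumerates a nonempty set: when D is empty, c0 is added to it. *)
have [d Dd] : exists d : nat -> C, D `<=` range d.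
  have /pfcard_geP[->|[d]] := Dcount; first by exists (fun=> c0).
  by exists d => c /(@surj _ _ _ _ d)[k _ <-]; exists k.
have [f0 f0P] := countable_product_select d s1Y
  (fun q => ug (pickle (0%N, q))).
set W := \bigcup_q _ in f0P.
have Wop : open W by apply: bigcup_open => q _; exact: (ug _).1.
have [|G [GP GW]] := Hurewicz_tube hurY Wop (d := d).
  by move=> k y; apply: f0P; split=> //; exists k.
(* Block 0 is the one that produced W; block m+1 takes care of the points of C
   outside [G m]. *)
have [p|f fP] := @glue_selections _ u
    (fun p => if p is m.+1 then ~` G m `*` setT else W).
  case: p => [|m]; first by exists f0.
  have [Gop dG] := GP m.
  have Gsmall := Dconc _ Gop (subset_trans Dd dG).
  exact: small_product_select Gsmall hurY s1Y (fun q => ug (pickle (m.+1, q))).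
exists f; apply/seteqP; split=> // -[c y] _; apply: fP.
have [Wcy|nW] := pselect (W (c, y)); first by exists 0%N.
have [m nG] : exists m, ~ G m c.
  apply: contrapT => no; apply: nW; apply: GW; split=> // m _.
  by apply: contrapT => nG; apply: no; exists m.
by exists m.+1.
Qed.
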